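(* For all integers $n\ge1$ and all $0<\sigma\le1$, $$\sup_{A\in S^{n^2-1}}\ \mathbf{E}_{Z\in B_{\mathbb{P}}(A,\sigma)}(\ln\kappa_F(Z))\le 6\ln n+2\ln\frac1\sigma+5.5,$$ where the expectation is over all $Z$ uniformly distributed in the disk $B_{\mathbb{P}}(A,\sigma)$ of radius $\sigma$ centered at $A$ in the sphere $S^{n^2-1}$ with respect to the projective distance.
   Context: $\mathbb{R}^{n\times n}$ carries the inner product $(A,B)\mapsto\mathrm{trace}(AB^T)$, with induced Frobenius norm $\|\ \|_F$; $S^{n^2-1}=\{A\in\mathbb{R}^{n\times n}\mid\|A\|_F=1\}$. $\kappa_F(A):=\|A\|_F\|A^{-1}\|$, where $\|A^{-1}\|$ is the operator norm with respect to the Euclidean norm ($\kappa_F(A)=\infty$ if $A$ is singular). $B_{\mathbb{P}}(A,\sigma)$ is the open ball in $S^{n^2-1}$ around $A$ of angular (Riemannian) radius $\arcsin\sigma$, endowed with the uniform probability measure (normalized Riemannian volume of the sphere). *)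

(* Defs.v *)
From HB Require Import structures.
From mathcomp Require Import all_boot all_order all_algebra.
From mathcomp Require Import all_classical all_reals all_analysis measurable_realfun.
From mathcomp Require Import lra.

Set Implicit Arguments.
Unset Strict Implicit.
Unset Printing Implicit Defensive.

Import Order.TTheory GRing.Theory Num.Theory.
Import numFieldNormedType.Exports.

Local Open Scope classical_set_scope.
Local Open Scope ring_scope.

Section lebesgue_measure_tuple.
Context {R : realType}.
Local Notation RT := (measurableTypeR R).

Definition lebesgue_cons n
    (mu : {sigma_finite_measure set (n.-tuple RT) -> \bar R})
    (A : set (n.+1.-tuple RT)) : \bar R :=
  (lebesgue_measure \x mu)%E
    [set xt : RT * n.-tuple RT | A [tuple of xt.1 :: xt.2]].

Section lebesgue_cons_measure.
Variables (n : nat) (mu : {sigma_finite_measure set (n.-tuple RT) -> \bar R}).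

Let cons_pre (A : set (n.+1.-tuple RT)) : measurable A ->
  measurable [set xt : RT * n.-tuple RT | A [tuple of xt.1 :: xt.2]].
Proof.
move=> mA; rewrite -[X in measurable X]setTI.
exact: (measurable_cons measurable_fst measurable_snd).
Qed.

Let lebesgue_cons0 : lebesgue_cons mu set0 = 0%E.
Proof. exact: measure0. Qed.

Let lebesgue_cons_ge0 A : (0 <= lebesgue_cons mu A)%E.
Proof. exact: measure_ge0. Qed.

Let lebesgue_cons_sigma_additive : semi_sigma_additive (lebesgue_cons mu).
Proof.
move=> F mF tF mUF; rewrite /lebesgue_cons.
rewrite (_ : [set _ | _] = \bigcup_k
    [set xt : RT * n.-tuple RT | F k [tuple of xt.1 :: xt.2]]) //.
apply: measure_semi_sigma_additive.
- by move=> k; exact: cons_pre.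
- by move=> i j _ _ [[x t] [/= Fi Fj]]; apply: tF => //; exists [tuple of x :: t].
- exact: (cons_pre mUF).
Qed.

HB.instance Definition _ := isMeasure.Build _ _ _ (lebesgue_cons mu)
  lebesgue_cons0 lebesgue_cons_ge0 lebesgue_cons_sigma_additive.

Let lebesgue_cons_sigma_finite : sigma_finite setT (lebesgue_cons mu).
Proof.
have /sigma_finiteP[F [TF ndF Foo]] := sigma_finiteT (@lebesgue_measure R).
have /sigma_finiteP[G [TG ndG Goo]] := sigma_finiteT mu.
exists (fun k => [set t | F k (thead t) /\ G k (behead_tuple t)]).
  apply/seteqP; split=> // t _.
  have : setT (thead t) by []; rewrite TF => -[i _ Fi].
  have : setT (behead_tuple t) by []; rewrite TG => -[j _ Gj].
  exists (maxn i j) => //; split.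
    by move: (Fi); exact/subsetPset/ndF/leq_maxl.
  by move: (Gj); exact/subsetPset/ndG/leq_maxr.
move=> k; have [mF F_oo] := Foo k; have [mG G_oo] := Goo k.
split.
  have mh : measurable_fun setT (fun t : n.+1.-tuple RT => thead t).
    exact: measurable_tnth.
  have mb : measurable_fun setT (fun t : n.+1.-tuple RT => behead_tuple t).
    exact: measurable_behead.
  have := measurableI _ _ (mh measurableT _ mF) (mb measurableT _ mG).
  by rewrite !setTI.
rewrite /lebesgue_cons (_ : [set _ | _] = F k `*` G k); last first.
  have beheadE (x : RT) (t : n.-tuple RT) :
      behead_tuple [tuple of x :: t] = t :> n.-tuple RT by exact/val_inj.
  by apply/seteqP; split=> -[x t] /=; rewrite theadE beheadE.
by rewrite product_measure1E// lte_mul_pinfty// ge0_fin_numE.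
Qed.

HB.instance Definition _ := Measure_isSigmaFinite.Build _ _ _ (lebesgue_cons mu)
  lebesgue_cons_sigma_finite.

End lebesgue_cons_measure.

(* Lebesgue measure on R ^ n, as an n-fold product measure. *)
Fixpoint lebesgue_tuple n : {sigma_finite_measure set (n.-tuple RT) -> \bar R} :=
  match n with
  | 0 => \d_([tuple] : 0.-tuple RT)
  | n'.+1 => lebesgue_cons (lebesgue_tuple n')
  end.

End lebesgue_measure_tuple.

Definition mx_display : measure_display -> measure_display.
Proof. exact. Qed.

Section measurable_matrix.
Context {d} {T : measurableType d} (m n : nat).

Definition measurable_mx : set (set 'M[T]_(m, n)) :=
  <<s \bigcup_(ij in [set: 'I_m * 'I_n])
        preimage_set_system setT (fun A : 'M[T]_(m, n) => A ij.1 ij.2)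
          measurable >>.

Let measurable_mx0 : measurable_mx set0.
Proof. exact: sigma_algebra0. Qed.

Let measurable_mxC A : measurable_mx A -> measurable_mx (~` A).
Proof. exact: sigma_algebraC. Qed.

Let measurable_mx_bigcup (F : _^nat) : (forall i, measurable_mx (F i)) ->
  measurable_mx (\bigcup_i (F i)).
Proof. exact: sigma_algebra_bigcup. Qed.

HB.instance Definition _ := @isMeasurable.Build (mx_display d)
  'M[T]_(m, n) measurable_mx measurable_mx0 measurable_mxC measurable_mx_bigcup.

Lemma measurable_coord (i : 'I_m) (j : 'I_n) :
  measurable_fun [set: 'M[T]_(m, n)] (fun A => A i j).
Proof.
move=> _ B mB; apply: sub_sigma_algebra.
by exists (i, j) => //; exists B.
Qed.

Lemma measurable_fun_mx d' (T' : measurableType d') (f : T' -> 'M[T]_(m, n)) :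
  (forall i j, measurable_fun setT (fun x => f x i j)) ->
  measurable_fun setT f.
Proof.
move=> mf; apply: measurability => // _ -[_ [-[i j] _ [B mB <-]] <-].
rewrite [X in _ @^-1` X]setTI; exact: (mf i j measurableT).
Qed.

End measurable_matrix.

Section lebesgue_measure_matrix.
Context {R : realType} (m n : nat).

Definition mx_of_tuple (t : (m * n).-tuple R) : 'M[R]_(m, n) :=
  \matrix_(i, j) tnth t (mxvec_index i j).

Lemma measurable_mx_of_tuple :
  measurable_fun [set: (m * n).-tuple (measurableTypeR R)] mx_of_tuple.
Proof.
apply: measurable_fun_mx => i j; rewrite /mx_of_tuple.
by under eq_fun do rewrite mxE; exact: measurable_tnth.
Qed.

Definition lebesgue_mx (A : set 'M[R]_(m, n)) : \bar R :=
  lebesgue_tuple (m * n) (mx_of_tuple @^-1` A).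

Let nu := measure_function_pushforward__canonical__measure_function_Measure
  (lebesgue_tuple (m * n)) measurable_mx_of_tuple.

HB.instance Definition _ := isMeasure.Build _ _ _ lebesgue_mx
  (measure0 nu) (measure_ge0 nu) (@measure_semi_sigma_additive _ _ _ nu).

End lebesgue_measure_matrix.

Section frobenius.
Context {R : realType}.

Definition frob_dot m n (A B : 'M[R]_(m, n)) : R := \tr (A *m B^T).

Definition frob_norm m n (A : 'M[R]_(m, n)) : R := Num.sqrt (frob_dot A A).

(* On column vectors frob_norm is the Euclidean norm. *)
Definition opnorm m n (A : 'M[R]_(m, n)) : R :=
  sup [set frob_norm (A *m x) | x in [set x : 'cV[R]_n | frob_norm x <= 1]].

Definition kappa_F n (A : 'M[R]_n) : \bar R :=
  if A \in unitmx then (frob_norm A * opnorm (invmx A))%:E else +oo%E.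

Definition unit_sphere n : set 'M[R]_n := [set A | frob_norm A = 1].

(* On the unit sphere this is the geodesic (Riemannian) distance. *)
Definition angle n (A B : 'M[R]_n) : R := acos (frob_dot A B).

Definition cap n (A : 'M[R]_n) (s : R) : set 'M[R]_n :=
  @unit_sphere n `&` [set Z | angle A Z < asin s].

End frobenius.
Arguments unit_sphere : clear implicits.

Section frobenius_measurable.
Context {R : realType}.

Lemma measurable_frob_dot m n d (T : measurableType d) (f g : T -> 'M[R]_(m, n)) :
  measurable_fun setT f -> measurable_fun setT g ->
  measurable_fun setT (fun x => frob_dot (f x) (g x)).
Proof.
move=> mf mg; rewrite /frob_dot /mxtrace.
apply: measurable_sum => i; under eq_fun do rewrite mxE.
apply: measurable_sum => j; under eq_fun do rewrite mxE.
by apply: measurable_funM; exact: measurableT_comp (measurable_coord _ _) _.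
Qed.

Lemma measurable_frob_norm m n :
  measurable_fun [set: 'M[R]_(m, n)] (@frob_norm R m n).
Proof.
have msqrt : measurable_fun setT (@Num.sqrt R).
  by apply: continuous_measurable_fun; exact: sqrt_continuous.
exact: (measurableT_comp msqrt
  (measurable_frob_dot (@measurable_id _ _ _) (@measurable_id _ _ _))).
Qed.

Lemma measurable_unit_sphere n : measurable (unit_sphere R n).
Proof.
have := @measurable_frob_norm n n measurableT _ (measurable_set1 1).
by rewrite setTI.
Qed.

Lemma measurable_acos : measurable_fun [set: R] (@acos R).
Proof.
have acos_out (x y : R) : ~~ (-1 <= x <= 1) -> ~~ (-1 <= y <= 1) ->
    acos x = acos y.
  move=> xN yN; rewrite !acos.unlock; congr get.
  by apply/seteqP; split=> z [_ cz]; [move: xN|move: yN];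
    rewrite -cz cos_geN1 cos_le1.
have mI : measurable `[(-1 : R), 1]%classic by exact: measurable_itv.
rewrite -(setUv `[(-1 : R), 1]%classic).
apply/measurable_funU => //; first exact: measurableC.
split.
  pose clamp (x : R) := Num.max (-1) (Num.min 1 x).
  have clampI x : -1 <= clamp x <= 1.
    by rewrite /clamp le_max lexx/= ge_max ge_min lexx andbT; lra.
  apply: (eq_measurable_fun (@acos R \o clamp)).
    move=> x; rewrite inE /= in_itv/= => /andP[x1 x2].
    by rewrite /clamp (min_idPr x2) (max_idPr x1).
  apply: nonincreasing_measurable => // x y xy /=.
  have [ax0 cax] := acos_def (clampI x); have [ay0 cay] := acos_def (clampI y).
  rewrite leNgt; apply/negP => h; move: h.
  rewrite -ltr_cos ?in_itv//= cax cay ltNge => /negP; apply.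
  by rewrite /clamp le_max2 // le_min2.
apply: (eq_measurable_fun (cst (acos 2))) => //.
move=> x; rewrite inE /= in_itv/= => /negP xN.
apply: acos_out => //; rewrite negb_and -!ltNge; apply/orP; right; lra.
Qed.

Lemma measurable_cap n (A : 'M[R]_n) s : measurable (cap A s).
Proof.
apply: measurableI; first exact: measurable_unit_sphere.
have mang : measurable_fun setT (angle A).
  exact: (measurableT_comp measurable_acos
    (measurable_frob_dot (measurable_cst A) (@measurable_id _ _ _))).
have := mang measurableT _ (measurable_itv `]-oo, asin s[).
rewrite setTI; congr measurable; apply/seteqP; split=> Z /=; by rewrite in_itv.
Qed.

End frobenius_measurable.

Section sphere_volume.
Context {R : realType} (n : nat).

Definition normalize (X : 'M[R]_n) : 'M[R]_n := (frob_norm X)^-1 *: X.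

Definition cone (V : set 'M[R]_n) : set 'M[R]_n :=
  [set X | V (normalize X) /\ 0 < frob_norm X <= 1].

(* Riemannian volume of the unit sphere, extended by 0 to the whole space: in polar
   coordinates dX = r ^ (n ^ 2 - 1) dr dvol, so that vol V is n ^ 2 times the
   Lebesgue measure of the cone of height 1 over V. *)
Definition sphere_volume (V : set 'M[R]_n) : \bar R :=
  ((n * n)%:R%:E * lebesgue_mx (cone V))%E.

Lemma measurable_normalize : measurable_fun setT normalize.
Proof.
apply: measurable_fun_mx => i j; rewrite /normalize.
under eq_fun do rewrite mxE -powR_inv1 ?sqrtr_ge0//.
apply: measurable_funM; last exact: measurable_coord.
exact: (measurableT_comp (measurable_powR (-1)) (@measurable_frob_norm R n n)).
Qed.

Let measurable_shell : measurable [set X : 'M[R]_n | 0 < frob_norm X <= 1].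
Proof.
have := @measurable_frob_norm R n n measurableT _ (measurable_itv `]0, 1]).
by rewrite setTI; congr measurable; apply/seteqP; split=> X /=; rewrite in_itv.
Qed.

Let dim : {nonneg R} := (n * n)%:R%:nng.

Let nu := mscale dim
  (measure_function_pushforward__canonical__measure_function_Measure
     (mrestr (@lebesgue_mx R n n) measurable_shell) measurable_normalize).

HB.instance Definition _ := isMeasure.Build _ _ _ sphere_volume
  (measure0 nu) (measure_ge0 nu) (@measure_semi_sigma_additive _ _ _ nu).

End sphere_volume.

(* The uniform probability measure on cap A s: sphere_volume restricted to the cap
   and divided by its mass. The second argument of mnormalize is used only if this
   mass is 0 or +oo, which does not occur for A on the sphere, 0 < s <= 1, 0 < n. *)
Definition uniform_cap {R : realType} n (A : 'M[R]_n) (s : R) :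
    probability 'M[R]_n R :=
  mnormalize (mrestr (@sphere_volume R n) (measurable_cap A s)) \d_A.

(* Main.v *)
Require Import Defs.
From HB Require Import structures.
From mathcomp Require Import all_boot all_order all_algebra.
From mathcomp Require Import all_classical all_reals all_analysis.
From mathcomp Require Import measurable_realfun lra ring.
From mathcomp Require finmap.
Import Order.TTheory GRing.Theory Num.Theory.
Import numFieldNormedType.Exports.
Set Implicit Arguments.
Unset Strict Implicit.
Unset Printing Implicit Defensive.
Local Open Scope classical_set_scope.
Local Open Scope ring_scope.

(* In polar coordinates the uniform measure on the cap becomes normalized Lebesgue measure
   on the convex body K (the cone of height 1 over the cap), where kappa_F X <= |X^-1|.
   By concavity of the logarithm, E ln kappa <= 2 ln E (kappa^(1/2)), and kappa^(1/2) is at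
   most the sum over the n^2 entries of X^-1 of the square roots of their absolute values.
   Moving X in the direction of the coordinate (j, i), the entry (i, j) of X^-1 is
   1 / (t + c) with c constant, and |t + c|^(-1/2) is integrable. So, averaging the
   integral over K over the translations by t in [-h, h] in this direction, one gets
   O(h^(-1/2)) times the volume of K + [-h, h]. Since K is convex and contains a ball
   of radius s^2 / 4, for h = s^2 / (8 n^2) that set lies in a translate of
   (1 + 1 / (2 n^2)) K, whose volume is at most e^(1/2) times that of K. *)

(** * Affine changes of variables *)

Section affine.
Context {R : realType}.
Local Notation RT := (measurableTypeR R).
Local Notation mu := (@lebesgue_measure R).

Lemma measurable_affine (a b : R) : measurable_fun setT (fun x : RT => a * x + b : RT).
Proof. by apply: measurable_funD => //; apply: measurable_funM. Qed.

(** Rescaled by [a], the pushforward of [mu] under the affine map gives every half-open interval its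
    length, and Lebesgue measure is the only measure that does so. *)
Lemma lebesgue_measure_affine (a b : R) (A : set RT) : 0 < a -> measurable A ->
  mu [set x | A (a * x + b)%R] = ((a^-1)%:E * mu A)%E.
Proof.
move=> a0 mA.
have mf : measurable_fun setT (fun x : RT => a * x + b : RT) by exact: measurable_affine.
pose nu := mscale (NngNum (ltW a0))
  (measure_function_pushforward__canonical__measure_function_Measure mu mf).
suff E : nu A = mu A.
  by rewrite -E /nu /mscale/= muleA -EFinM mulVf ?gt_eqF// mul1e.
apply/esym/lebesgue_measure_unique => //= _ [[x y]] _ <-.
rewrite /nu /mscale/= /pushforward.
have -> : (fun x0 : RT => a * x0 + b) @^-1` `]x, y] =
    `] (x - b) / a, (y - b) / a ]%classic.
  apply/seteqP; split => z /=; rewrite !in_itv/= ltr_pdivrMr// ler_pdivlMr// ltrBlDr lerBrDr;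
  by rewrite [z * a]mulrC.
rewrite !lebesgue_measure_itv/= !lte_fin ltr_pM2r ?invr_gt0// ltrD2r.
case: ifP => _; last by rewrite mule0.
rewrite !EFinN -!EFinB -EFinM; congr EFin; field; lra.
Qed.

Lemma integral_affine (a b : R) (f : RT -> \bar R) : 0 < a ->
  measurable_fun setT f -> (forall x, 0 <= f x)%E ->
  (\int[mu]_x f (a * x + b)%R = (a^-1)%:E * \int[mu]_x f x)%E.
Proof.
move=> a0 mf f0.
have ai : 0 <= a^-1 by rewrite invr_ge0 ltW.
have mg : measurable_fun setT (fun x : RT => a * x + b : RT) by exact: measurable_affine.
have := @ge0_integral_pushforward _ _ _ _ R _ mg mu setT f measurableT mf (fun x _ => f0 x).
rewrite preimage_setT => <-.
rewrite -(@ge0_integral_mscale _ _ _ mu setT measurableT (NngNum ai) f)//.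
apply: eq_measure_integral => A mA _.
exact: (lebesgue_measure_affine b a0 mA).
Qed.

Definition affine_tuple (a : R) n (b t : n.-tuple R) : n.-tuple R :=
  [tuple a * tnth t i + tnth b i | i < n].

Lemma affine_tuple_cons (a : R) n (b : n.+1.-tuple R) (x : R) (t : n.-tuple R) :
  affine_tuple a b [tuple of x :: t] =
  [tuple of a * x + thead b :: affine_tuple a (behead_tuple b) t].
Proof.
apply: eq_from_tnth => i; rewrite tnth_mktuple.
case: (unliftP ord0 i) => [j|] ->; rewrite ?tnth0 ?tnthS// ?tnth_mktuple.
rewrite tnth_behead; congr (_ + tnth _ _); apply: val_inj.
by rewrite /= inordK// ltnS ltn_ord.
Qed.

(** Induction by slicing: the slice at [x] of the preimage is the preimage of the slice at
    [a * x + thead b]. The induction hypothesis gives [a ^- n] and the outer integral one more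
    factor [a^-1]. *)
Lemma lebesgue_tuple_affine (a : R) n (b : n.-tuple R) (A : set (n.-tuple RT)) :
  0 < a -> measurable A ->
  lebesgue_tuple n [set t | A (affine_tuple a b t)] =
    ((a ^- n)%:E * lebesgue_tuple n A)%E.
Proof.
move=> a0; elim: n b A => [|n IH] b A mA.
  rewrite expr0 invr1 mul1e; congr (lebesgue_tuple _ _).
  by apply/seteqP; split => t /=; rewrite (tuple0 (affine_tuple _ _ _)) (tuple0 t).
rewrite /= /lebesgue_cons.
set B := [set xt : RT * n.-tuple RT | A [tuple of xt.1 :: xt.2]].
have mB : measurable B.
  rewrite -[X in measurable X]setTI.
  exact: (measurable_cons measurable_fst measurable_snd).
set g := fun x => lebesgue_tuple n (xsection B x).
have mg : measurable_fun setT g by exact: measurable_fun_xsection.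
transitivity (\int[mu]_x ((a ^- n)%:E * g (a * x + thead b)%R))%E.
  apply: eq_integral => x _; rewrite /g -(IH (behead_tuple b)); last first.
    exact: measurable_xsection.
  congr (lebesgue_tuple _ _); apply/seteqP; split => t;
  by rewrite /xsection/= !inE /B/= affine_tuple_cons.
have an : 0 <= a ^- n by rewrite invr_ge0 exprn_ge0 ?ltW.
rewrite ge0_integralZl//; last first.
  exact: (measurableT_comp mg (measurable_affine a (thead b))).
rewrite integral_affine// muleA -EFinM -invfM -exprSr.
by [].
Qed.

End affine.

(** * Lebesgue measure on matrices: homotheties, cubes, sigma-finiteness *)

Section matrix_measure.
Context {R : realType}.
Local Notation RT := (measurableTypeR R).
Local Notation mu := (@lebesgue_measure R).

Definition tuple_cube n (d : R) : set (n.-tuple RT) := [set t | forall i, `|tnth t i| <= d].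

Lemma measurable_tuple_cube n d : measurable (@tuple_cube n d).
Proof.
rewrite (_ : tuple_cube d = \bigcap_(i in [set: 'I_n]) [set t : n.-tuple RT | `|tnth t i| <= d]).
  apply: fin_bigcap_measurable => // i _.
  have := @measurable_tnth _ RT n i measurableT _ (measurable_itv `[-d, d]).
  by rewrite setTI; congr measurable; apply/seteqP; split => t /=; rewrite in_itv/= ler_norml.
by apply/seteqP; split => t /= h i; [move=> _; exact: h|exact: (h i I)].
Qed.

Lemma lebesgue_tuple_cube n d : 0 <= d ->
  lebesgue_tuple n (@tuple_cube n d) = ((2 * d) ^+ n)%:E.
Proof.
move=> d0; elim: n => [|n IH].
  rewrite expr0 /= diracE mem_set//; by case.
rewrite /= /lebesgue_cons.
rewrite (_ : [set _ | _] = `[-d, d]%classic `*` tuple_cube d); last first.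
  apply/seteqP; split => -[x t]; rewrite /tuple_cube /= in_itv/= -ler_norml.
    move=> h; split; first by have := h ord0; rewrite tnth0.
    by move=> i; have := h (lift ord0 i); rewrite tnthS.
  by move=> [hx ht] i; case: (unliftP ord0 i) => [j|] ->; rewrite ?tnth0 ?tnthS.
rewrite product_measure1E//; last exact: measurable_tuple_cube.
rewrite IH exprS EFinM; congr (_ * _)%E.
apply: etrans (lebesgue_measure_itv `[-d, d]) _.
rewrite /= lte_fin; case: ifPn => [_|].
  by rewrite -EFinB; congr (_%:E); ring.
rewrite -leNgt => h; have -> : d = 0 by lra.
by rewrite mulr0.
Qed.

Variables (m n : nat).
Local Notation lmu := (@lebesgue_mx R m n).

Lemma lebesgue_mx_affine (a : R) (B : 'M[R]_(m, n)) (V : set 'M[R]_(m, n)) :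
  0 < a -> measurable V ->
  lmu [set X | V (a *: X + B)] = ((a ^- (m * n))%:E * lmu V)%E.
Proof.
move=> a0 mV; rewrite /lebesgue_mx.
have mV' : measurable (mx_of_tuple (R := R) (m := m) (n := n) @^-1` V).
  rewrite -[X in measurable X]setTI; exact: (measurable_mx_of_tuple measurableT mV).
pose b : (m * n).-tuple R := [tuple mxvec B 0 i | i < (m * n)].
rewrite -(lebesgue_tuple_affine b a0 mV'); congr (lebesgue_tuple _ _).
have E t : a *: mx_of_tuple t + B = mx_of_tuple (affine_tuple a b t).
  by apply/matrixP => i j; rewrite !mxE !tnth_mktuple mxvecE.
by apply/seteqP; split => t /=; rewrite E.
Qed.

Definition mx_cube (Q : 'M[R]_(m, n)) d : set 'M[R]_(m, n) :=
  [set X | forall i j, `|X i j - Q i j| <= d].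

Lemma measurable_mx_cube Q d : measurable (mx_cube Q d).
Proof.
rewrite (_ : mx_cube Q d = \bigcap_(ij in [set: 'I_m * 'I_n])
    [set X : 'M[R]_(m, n) | `|X ij.1 ij.2 - Q ij.1 ij.2| <= d]).
  apply: fin_bigcap_measurable => // -[i j] _ /=.
  have := @measurable_coord _ R m n i j measurableT _
    (measurable_itv `[(Q i j - d), (Q i j + d)]).
  by rewrite setTI; congr measurable; apply/seteqP; split => t /=; rewrite in_itv/= ler_distl.
apply/seteqP; split => t /= h; first by move=> ij _; exact: h.
by move=> i j; exact: (h (i, j) I).
Qed.

Lemma lebesgue_mx_cube Q d : 0 <= d -> lmu (mx_cube Q d) = ((2 * d) ^+ (m * n))%:E.
Proof.
move=> d0; rewrite -lebesgue_tuple_cube//.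
have := @lebesgue_mx_affine 1 (- Q) (mx_cube 0 d) ltr01 (measurable_mx_cube 0 d).
rewrite expr1n invr1 mul1e.
rewrite (_ : [set X | _] = mx_cube Q d).
  move=> ->; rewrite /lebesgue_mx; congr (lebesgue_tuple _ _).
  apply/seteqP; split => t /= h => [k|i j]; last by rewrite !mxE subr0.
  by case/mxvec_indexP: k => i j; have := h i j; rewrite !mxE subr0.
by apply/seteqP; split => X /= h i j; have := h i j; rewrite !mxE mul1r subr0.
Qed.

(** The cubes of integer radius exhaust the space; Tonelli's theorem in [translation_average] relies
    on this. *)
Let lebesgue_mx_sigma_finite : sigma_finite setT lmu.
Proof.
exists (fun k => mx_cube 0 k%:R).
  apply/seteqP; split => // X _.
  pose M := \sum_i \sum_j `|X i j|.
  exists (Num.truncn M).+1 => // i j; rewrite mxE subr0.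
  apply: (@le_trans _ _ M); last by apply/ltW; rewrite truncnS_gt.
  rewrite /M (bigD1 i)//= (bigD1 j)//= -addrA lerDl addr_ge0//.
    by apply: sumr_ge0.
  by apply: sumr_ge0 => ? _; apply: sumr_ge0.
move=> k; split; first exact: measurable_mx_cube.
by rewrite lebesgue_mx_cube// ltry.
Qed.

HB.instance Definition _ := Measure_isSigmaFinite.Build _ _ _ lmu
  lebesgue_mx_sigma_finite.

End matrix_measure.

(** * Translation invariance and averaging along a line *)

Section translation.
Context {R : realType} (m n : nat).
Local Notation RT := (measurableTypeR R).
Local Notation mu := (@lebesgue_measure R).
Local Notation lmu := (@lebesgue_mx R m n).

Lemma measurable_mx_line (E : 'M[R]_(m, n)) :
  measurable_fun setT (fun p : 'M[R]_(m, n) * RT => p.1 + (p.2 : R) *: E).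
Proof.
apply: measurable_fun_mx => i j.
rewrite (_ : (fun _ => _) = fun p : 'M[R]_(m, n) * RT => (p.1 i j + p.2 * E i j : RT)); last first.
  by apply/funext => p; rewrite !mxE.
apply: measurable_funD; last exact: measurable_funM.
exact: (measurableT_comp (measurable_coord i j)).
Qed.

Lemma measurable_affine_mx (a : R) (B : 'M[R]_(m, n)) :
  measurable_fun setT (fun X : 'M[R]_(m, n) => a *: X + B).
Proof.
apply: measurable_fun_mx => i j.
rewrite (_ : (fun _ => _) = fun X : 'M[R]_(m, n) => (a * X i j + B i j : RT)); last first.
  by apply/funext => X; rewrite !mxE.
apply: measurable_funD => //; apply: measurable_funM => //; exact: measurable_coord.
Qed.

Lemma measurable_mx_translate (B : 'M[R]_(m, n)) :
  measurable_fun setT (fun X : 'M[R]_(m, n) => X + B).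
Proof.
by have := measurable_affine_mx 1 B; under eq_fun do rewrite scale1r.
Qed.

Lemma integral_translate (F : 'M[R]_(m, n) -> \bar R) (E : 'M[R]_(m, n)) :
  measurable_fun setT F -> (forall X, 0 <= F X)%E ->
  (\int[lmu]_X F (X + E)%R = \int[lmu]_X F X)%E.
Proof.
move=> mF F0.
have mg := measurable_mx_translate E.
have := @ge0_integral_pushforward _ _ _ _ R _ mg lmu setT F measurableT mF (fun x _ => F0 x).
rewrite preimage_setT => <-.
apply: eq_measure_integral => A mA _.
have := lebesgue_mx_affine E ltr01 mA.
rewrite expr1n invr1 mul1e => H; apply: etrans H; congr (lmu _).
by apply/seteqP; split => X /=; rewrite scale1r.
Qed.

(** By Tonelli the integrals can be exchanged, and for fixed [t] the integral over [X] does not see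
    the shift. Integrals over matrices are thus reduced to one-dimensional ones in the direction
    [E]. *)
Lemma translation_average (F : 'M[R]_(m, n) -> \bar R) (E : 'M[R]_(m, n)) (T : set RT) :
  measurable T -> measurable_fun setT F -> (forall X, 0 <= F X)%E ->
  (\int[lmu]_X \int[mu]_t ((\1_T t)%:E * F (X + (t : R) *: E)%R) =
   mu T * \int[lmu]_X F X)%E.
Proof.
move=> mT mF F0.
pose f (p : 'M[R]_(m, n) * RT) := ((\1_T p.2)%:E * F (p.1 + (p.2 : R) *: E)%R)%E.
have mf : measurable_fun setT f.
  apply: emeasurable_funM.
    apply/measurable_EFinP; exact: measurableT_comp.
  exact: (measurableT_comp mF (measurable_mx_line E)).
have f0 p : (0 <= f p)%E by rewrite mule_ge0.
rewrite (fubini_tonelli (m1 := lmu) (m2 := mu) f)//.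
transitivity (\int[mu]_t ((\1_T t)%:E * \int[lmu]_X F X))%E.
  apply: eq_integral => t _; rewrite -(integral_translate (t *: E))//.
  rewrite /f/= ge0_integralZl//.
  exact: (measurableT_comp mF (measurable_mx_translate _)).
rewrite ge0_integralZr//; last 2 first.
- by apply/measurable_EFinP.
- by apply: integral_ge0.
by rewrite integral_indic// setIT.
Qed.

End translation.

(** * Singular matrices form a null set *)

Section det.
Context {R : realType}.
Local Notation RT := (measurableTypeR R).
Local Notation mu := (@lebesgue_measure R).

Lemma measurable_det n d (T : measurableType d) (f : T -> 'M[R]_n) :
  (forall i j, measurable_fun setT (fun x => f x i j)) ->
  measurable_fun setT (fun x => \det (f x)).
Proof.
move=> mf; rewrite /determinant; apply: measurable_sum => s.
by apply: measurable_funM => //; apply: measurable_prod => i.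
Qed.

Lemma measurable_adj n (i j : 'I_n) :
  measurable_fun setT (fun X : 'M[R]_n => (\adj X) i j).
Proof.
rewrite (_ : (fun _ => _) = fun X : 'M[R]_n => (-1) ^+ (j + i) * \det (row' j (col' i X))); last first.
  by apply/funext => X; rewrite !mxE.
apply: measurable_funM => //; apply: measurable_det => k l.
under eq_fun do rewrite !mxE.
exact: measurable_coord.
Qed.

Lemma finite_roots (p : {poly R}) : p != 0 -> finite_set [set t | root p t].
Proof.
move=> p0; apply: contrapT => /(infinite_set_fset (size p)) [B Bp].
apply/negP; rewrite -ltnNge.
apply: max_poly_roots (finmap.fset_uniq B) => //.
by apply/allP => t tB; exact: Bp.
Qed.

(** The determinant is the value at [t] of the characteristic polynomial of [- X], which is
    monic. *)
Lemma finite_singular_shift n (X : 'M[R]_n) :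
  finite_set [set t : R | \det (X + t *: 1%:M) = 0].
Proof.
apply: sub_finite_set (finite_roots (monic_neq0 (char_poly_monic (- X)))).
move=> t /= Xt; rewrite /root /char_poly -horner_evalE -det_map_mx; apply/eqP.
rewrite -[RHS]Xt; congr (\det _); apply/matrixP => i j.
by rewrite !mxE /= horner_evalE !hornerE/= !hornerMn hornerX; ring.
Qed.

Definition singular n : set 'M[R]_n := [set X | \det X = 0].

Lemma measurable_singular n : measurable (@singular n).
Proof.
have := measurable_det (@measurable_coord _ R n n) measurableT (measurable_set1 0).
by rewrite setTI.
Qed.

(** The indicator is averaged over the shifts by [t *: 1%:M] with [t] in [0, 1]. Each such line
    meets the singular set in finitely many points, so every inner integral is 0. *)
Lemma lebesgue_mx_singular n : lebesgue_mx (@singular n) = 0%E.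
Proof.
pose F (X : 'M[R]_n) : \bar R := (\1_(@singular n) X)%:E.
have mF : measurable_fun setT F.
  by apply/measurable_EFinP/measurable_indic; exact: measurable_singular.
have := @translation_average R n n F 1%:M `[0, 1]%classic (measurable_itv _) mF.
rewrite lebesgue_measure_itv/= lte_fin ltr01 oppr0 adde0 mul1e.
rewrite /F integral_indic//; last exact: measurable_singular.
rewrite setIT => H; apply: etrans (esym (H _)) _ => [X|]; first by rewrite lee_fin.
apply: integral0_eq => X _; pose Z := [set t : R | \det (X + t *: 1%:M) = 0].
have cZ : countable Z by exact/finite_set_countable/finite_singular_shift.
have mZ : measurable (Z : set RT).
  by apply: countable_measurable => // t; exact: measurable_set1.
transitivity (\int[mu]_t (\1_(`[0%R, 1%R]%classic `&` Z) t)%:E)%E.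
  by apply: eq_integral => t _; rewrite indicI EFinM.
rewrite integral_indic//; last exact: measurableI.
rewrite setIT; apply: (@subset_measure0 _ _ _ mu _ Z) => //.
- exact: measurableI.
- exact: countable_lebesgue_measure0.
Qed.
End det.

(** * Inverse square roots *)

Section inverse_sqrt.
Context {R : realType}.
Local Notation RT := (measurableTypeR R).
Local Notation mu := (@lebesgue_measure R).

Lemma measurable_sqrt : measurable_fun setT (Num.sqrt : RT -> RT).
Proof. by apply: continuous_measurable_fun; exact: sqrt_continuous. Qed.

(** This is |u|^(-1/2), with value 0 at [u = 0] since the inverse of 0 is 0. *)
Definition rho (u : R) : R := Num.sqrt `|u^-1|.

Lemma rho0 : rho 0 = 0. Proof. by rewrite /rho invr0 normr0 sqrtr0. Qed.

Lemma rhoN u : rho (- u) = rho u. Proof. by rewrite /rho invrN normrN. Qed.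

Lemma rho_ge0 u : 0 <= rho u. Proof. exact: sqrtr_ge0. Qed.

Lemma rho_gt0E u : 0 < u -> rho u = (Num.sqrt u)^-1.
Proof. by move=> u0; rewrite /rho gtr0_norm ?invr_gt0// sqrtrV// ltW. Qed.

Lemma measurable_rho : measurable_fun setT (rho : RT -> RT).
Proof.
apply: (measurableT_comp measurable_sqrt).
rewrite (_ : (fun _ => _) = fun u : RT => `|u| `^ (-1) : RT); last first.
  by apply/funext => u; rewrite powR_inv1// normfV.
exact: (measurableT_comp (measurable_powR (-1)) (@normr_measurable R setT)).
Qed.

(** Fundamental theorem of calculus with antiderivative [2 * Num.sqrt x], away from the singularity
    of [rho] at 0. *)
Lemma integral_rho_itvcc (a b : R) : 0 < a -> a < b ->
  (\int[mu]_(x in `[a, b]) (rho x)%:E = (2 * Num.sqrt b - 2 * Num.sqrt a)%:E)%E.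
Proof.
move=> a0 ab; rewrite EFinB.
have dF (x : R) : 0 < x -> is_derive x 1 (fun x => 2 * Num.sqrt x) (rho x).
  move=> x0; have := is_derive1_sqrt x0 => H.
  have -> : rho x = 2 *: ((2 * Num.sqrt x)^-1 : R^o).
    by rewrite rho_gt0E// /GRing.scale/= invfM mulrA divff// mul1r.
  exact: is_deriveZ.
have cF : continuous (fun x : R => 2 * Num.sqrt x).
  move=> x; apply: cvgM; first exact: cvg_cst.
  exact: sqrt_continuous.
apply: (@continuous_FTC2 R rho (fun x => 2 * Num.sqrt x) a b ab).
- apply: (@subspace_eq_continuous _ _ _ (fun x => (Num.sqrt x)^-1)).
    move=> x /set_mem; rewrite /= in_itv/= => /andP[ax _].
    by rewrite /from_subspace /= rho_gt0E// (lt_le_trans a0).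
  apply: continuous_in_subspaceT => x /set_mem; rewrite /= in_itv/= => /andP[ax _].
  apply: cvgV; last exact: sqrt_continuous.
  by rewrite gt_eqF// sqrtr_gt0 (lt_le_trans a0).
- split.
  + move=> x; rewrite in_itv/= => /andP[ax _].
    by have [] := dF x (lt_trans a0 ax).
  + exact/cvg_at_right_filter/cF.
  + exact/cvg_at_left_filter/cF.
- move=> x; rewrite in_itv/= => /andP[ax _].
  by rewrite derive1E; have [_] := dF x (lt_trans a0 ax).
Qed.

(** Monotone convergence along closed intervals whose left ends tend to 0. *)
Lemma integral_rho_itvoc (b : R) : 0 < b ->
  (\int[mu]_(x in `]0%R, b]) (rho x)%:E <= (2 * Num.sqrt b)%:E)%E.
Proof.
(* The offset 2 keeps the left end below [b] even for [k = 0], as [integral_rho_itvcc] requires. *)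
move=> b0; pose F (k : nat) := `[b / k.+2%:R, b]%classic : set RT.
have -> : `]0, b]%classic = \bigcup_k F k.
  apply/seteqP; split => x /=.
    rewrite in_itv/= => /andP[x0 xb]; exists (Num.truncn (b / x)) => //=.
    rewrite /F/= in_itv/= xb andbT ler_pdivrMr// mulrC -ler_pdivrMr//.
    apply/ltW; apply: lt_le_trans (truncnS_gt _) _; by rewrite ler_nat.
  move=> [k _]; rewrite /F/= !in_itv/= => /andP[bx ->]; rewrite andbT.
  by apply: lt_le_trans bx; rewrite divr_gt0.
have mr := measurable_rho.
have := @ge0_nondecreasing_set_cvg_integral _ RT R F (EFin \o rho) mu.
have ndF : nondecreasing_seq F.
  apply/nondecreasing_seqP => k; apply/subsetPset => x; rewrite /F/= !in_itv/= => /andP[kx ->].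
  rewrite andbT; apply: le_trans kx; rewrite ler_pM2l// lef_pV2 ?posrE//.
  by rewrite ler_nat.
move=> /(_ ndF)H.
have {}H : (\int[mu]_(x in F i) (EFin \o rho) x)%E @[i --> \oo] -->
    (\int[mu]_(x in \bigcup_k F k) (EFin \o rho) x)%E.
  apply: H => [i|i|i x _].
  - exact: measurable_itv.
  - by apply: measurable_funTS; apply/measurable_EFinP.
  - by rewrite lee_fin rho_ge0.
rewrite -(cvg_lim _ H)//; apply: lime_le; first by apply/cvg_ex; eexists; exact: H.
apply: nearW => k; rewrite /F /= integral_rho_itvcc ?divr_gt0//.
  by rewrite lee_fin gerBl mulr_ge0// sqrtr_ge0.
by rewrite ltr_pdivrMr// ltr_pMr// ltr1n.
Qed.

Lemma integral_rho_sym (e : R) : 0 < e ->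
  (\int[mu]_x (\1_`[(- e)%R, e]%classic x * rho x)%:E <= (4 * Num.sqrt e)%:E)%E.
Proof.
move=> e0; pose g (x : R) := \1_`]0%R, e]%classic x * rho x.
have mg : measurable_fun setT (g : RT -> RT).
  by apply: measurable_funM; [exact: measurable_indic|exact: measurable_rho].
have g0 x : 0 <= g x by rewrite mulr_ge0// ?rho_ge0.
(* At [x = 0] the indicator is 1 on the left and 0 on the right; both sides agree because
   [rho 0 = 0]. *)
have E x : \1_`[(- e)%R, e]%classic x * rho x = g x + g (- x).
  rewrite /g rhoN !indicE !mem_setE !in_itv/=.
  have [x0|x0|->] := ltgtP x 0; last by rewrite rho0 !mulr0 addr0.
    by rewrite oppr_gt0 x0 (ltW (lt_trans x0 e0)) andbT mul0r add0r lerNl.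
  rewrite oppr_gt0 ltNge (ltW x0)/= mul0r addr0.
  by rewrite (le_trans _ (ltW x0))// oppr_le0 ltW.
under eq_integral do rewrite E EFinD.
have mgN : measurable_fun setT (fun x : RT => (g (- x))).
  apply: (measurableT_comp mg); exact: measurable_funN.
rewrite ge0_integralD//; [|by move=> ? _; rewrite lee_fin|exact/measurable_EFinP|
  by move=> ? _; rewrite lee_fin|exact/measurable_EFinP].
have I : (\int[mu]_x (g x)%:E <= (2 * Num.sqrt e)%:E)%E.
  apply: le_trans (integral_rho_itvoc e0); rewrite [leRHS]integral_mkcond/=.
  rewrite le_eqVlt; apply/orP; left; apply/eqP; apply: eq_integral => x _.
  rewrite /g patchE indicE; case: ifPn => _; by rewrite ?mul1r ?mul0r.
have -> : (\int[mu]_x (g (- x))%:E = \int[mu]_x (g x)%:E)%E.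
  have mN : measurable_fun setT (-%R : RT -> RT) by exact: measurable_funN.
  have mgE : measurable_fun setT (EFin \o (g : RT -> R)) by exact/measurable_EFinP.
  have gE0 : {in [set: RT], forall x, (0 <= (EFin \o g) x)%E}.
    by move=> x _; rewrite lee_fin.
  have := ge0_integral_pushforward mN mu measurableT mgE gE0.
  rewrite preimage_setT => <-.
  by apply: eq_measure_integral => A mA _; exact: lebesgue_measureN.
apply: le_trans (leeD I I) _; rewrite -EFinD lee_fin; lra.
Qed.

(** The bound is uniform in [c]. Where [|t + c| <= e], the integral is at most that of
    [integral_rho_sym], namely 4 sqrt e. Elsewhere [rho] is at most 1 / sqrt e, on an interval of
    length 4 e, which gives another 4 sqrt e. *)
Lemma integral_rho_shift (e c : R) : 0 < e ->
  (\int[mu]_t (\1_`[(- (2 * e))%R, (2 * e)%R]%classic t * rho (t + c))%:E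
     <= (8 * Num.sqrt e)%:E)%E.
Proof.
move=> e0.
pose k (x : R) := \1_`[(- e)%R, e]%classic x * rho x.
have mk : measurable_fun setT (k : RT -> RT).
  by apply: measurable_funM; [exact: measurable_indic|exact: measurable_rho].
have k0 x : 0 <= k x by rewrite mulr_ge0// ?rho_ge0.
have ms : measurable_fun setT (fun x : RT => x + c : RT) by exact: measurable_funD.
have mkc : measurable_fun setT (fun t : RT => k (t + c)) by exact: (measurableT_comp mk).
pose J := `[(- (2 * e))%R, (2 * e)%R]%classic : set RT.
have mJ : measurable J by exact: measurable_itv.
apply: (@le_trans _ _ (\int[mu]_t ((\1_J t)%:E * (Num.sqrt e)^-1%:E + (k (t + c))%:E))%E).
  apply: ge0_le_integral => //.
  - by move=> t _; rewrite lee_fin mulr_ge0// rho_ge0.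
  - apply/measurable_EFinP; apply: measurable_funM; first exact: measurable_indic.
    exact: (measurableT_comp measurable_rho).
  - apply: emeasurable_funD; last exact/measurable_EFinP.
    by apply: emeasurable_funM => //; exact/measurable_EFinP/measurable_indic.
  move=> t _; rewrite -EFinM -EFinD lee_fin /k.
  rewrite [X in _ <= _ + X * _]indicE mem_setE in_itv/= -ler_norml.
  case: (leP `|t + c| e) => h; rewrite ?mul1r ?mul0r ?addr0.
    apply: ler_wpDl; first by rewrite mulr_ge0// invr_ge0 sqrtr_ge0.
    by apply: ler_piMl; rewrite ?rho_ge0// indicE lern1 leq_b1.
  apply: ler_wpM2l => //; rewrite /rho -(sqrtrV (ltW e0)) ler_wsqrtr// normfV lef_pV2 ?posrE//; first exact: ltW.
  exact: lt_trans h.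
have c0 : (0 <= (Num.sqrt e)^-1%:E :> \bar R)%E by rewrite lee_fin invr_ge0 sqrtr_ge0.
have mJE : measurable_fun setT (fun t : RT => (\1_J t)%:E : \bar R).
  exact/measurable_EFinP/measurable_indic.
rewrite ge0_integralD//.
2: exact: emeasurable_funM.
2: by move=> t _; rewrite lee_fin.
2: exact/measurable_EFinP.
have -> : (\int[mu]_t (k (t + c))%:E = \int[mu]_t (k t)%:E)%E.
  have := @integral_affine R 1 c (EFin \o k) ltr01.
  rewrite invr1 mul1e => <-//; [|exact/measurable_EFinP].
  by apply: eq_integral => t _; rewrite /= mul1r.
apply: le_trans (leeD _ (integral_rho_sym e0)) _ => //.
rewrite ge0_integralZr//.
have -> : (\int[mu]_t (\1_J t)%:E = (4 * e)%:E)%E.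
  rewrite integral_indic// setIT; apply: etrans (lebesgue_measure_itv _) _.
  by rewrite /= lte_fin ifT; [rewrite -EFinB; congr EFin; ring|lra].
rewrite -EFinM -EFinD lee_fin.
have s0 : 0 < Num.sqrt e by rewrite sqrtr_gt0.
have -> : 4 * e * (Num.sqrt e)^-1 = 4 * Num.sqrt e.
  by rewrite -{1}(sqr_sqrtr (ltW e0)) expr2 !mulrA mulfK ?gt_eqF.
set w := Num.sqrt e; lra.
Qed.

End inverse_sqrt.

(** * Perturbing one entry of a matrix *)

Section row_perturbation.
Context {R : realType} (n : nat).
Local Notation RT := (measurableTypeR R).
Local Notation mu := (@lebesgue_measure R).
Local Notation lmu := (@lebesgue_mx R n n).

(** The cofactor involved deletes row [j], the only row that changes. *)
Lemma adj_add_delta (X : 'M[R]_n) (i j : 'I_n) (t : R) :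
  (\adj (X + t *: delta_mx j i)) i j = (\adj X) i j.
Proof.
rewrite !mxE /cofactor; congr (_ * \det _); apply/matrixP => k l.
by rewrite !mxE eq_sym (negbTE (neq_lift j k)) mulr0 addr0.
Qed.

(** Expansion along row [j], whose cofactors do not depend on [t]. *)
Lemma det_add_delta (X : 'M[R]_n) (i j : 'I_n) (t : R) :
  \det (X + t *: delta_mx j i) = \det X + t * (\adj X) i j.
Proof.
rewrite (expand_det_row _ j) (expand_det_row X j).
have E k : cofactor (X + t *: delta_mx j i) j k = cofactor X j k.
  rewrite /cofactor; congr (_ * \det _); apply/matrixP => k1 l.
  by rewrite !mxE eq_sym (negbTE (neq_lift j k1)) mulr0 addr0.
under eq_bigr do rewrite E !mxE eqxx /= mulrDl.
rewrite big_split/=; congr (_ + _).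
rewrite (bigD1 i)//= eqxx mulr1 big1 ?addr0; first by rewrite !mxE.
by move=> k /negbTE ki; rewrite ki mulr0 mul0r.
Qed.

(* The entries of the inverse of X; the junk value 0 on singular matrices. *)
Definition inv_entry (i j : 'I_n) (X : 'M[R]_n) : R := (\adj X) i j / \det X.

Definition root_entry i j X := Num.sqrt `|inv_entry i j X|.

Lemma root_entry_ge0 i j X : 0 <= root_entry i j X.
Proof. exact: sqrtr_ge0. Qed.

(** With [a] the adjugate entry, the entry of the inverse is a / (det X + t a) = 1 / (t + det X /
    a). If [a = 0] the entry vanishes. *)
Lemma root_entry_add_delta i j (X : 'M[R]_n) (t : R) :
  root_entry i j (X + t *: delta_mx j i) <= rho (t + \det X / (\adj X) i j).
Proof.
rewrite /root_entry /inv_entry adj_add_delta det_add_delta /rho.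
set a := (\adj X) i j; have [->|a0] := eqVneq a 0.
  by rewrite mul0r normr0 sqrtr0 sqrtr_ge0.
by rewrite -invf_div mulrDl mulfK// addrC.
Qed.

Lemma measurable_root_entry i j :
  measurable_fun setT (root_entry i j : 'M[R]_n -> RT).
Proof.
have mdet : measurable_fun setT (fun X : 'M[R]_n => \det X).
  exact: (measurable_det (@measurable_coord _ R n n)).
rewrite (_ : root_entry i j = fun X => Num.sqrt `|(\adj X) i j| * rho (\det X)).
  apply: measurable_funM; last exact: (measurableT_comp measurable_rho).
  apply: (measurableT_comp measurable_sqrt); apply: (measurableT_comp (@normr_measurable R setT)).
  exact: measurable_adj.
by apply/funext => X; rewrite /root_entry /inv_entry normrM sqrtrM.
Qed.

(** The set is the image of [K] under the homothety of centre [Q] and ratio [1 + a], which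
    multiplies volumes by (1 + a)^(n^2). *)
Lemma lebesgue_mx_dilate (a : R) (Q : 'M[R]_n) (K : set 'M[R]_n) : 0 <= a ->
  measurable K -> (lmu [set X | K ((1 + a)^-1 *: (X + a *: Q))] <=
    (expR ((n * n)%:R * a))%:E * lmu K)%E.
Proof.
move=> a0 mK.
have a1 : 0 < 1 + a by lra.
under eq_set do rewrite scalerDr scalerA.
rewrite lebesgue_mx_affine ?invr_gt0// lee_wpmul2r// lee_fin exprVn invrK.
by rewrite mulrC expRM_natr lerXn2r ?nnegrE ?expR_ge0 ?expR_ge1Dx ?ltW.
Qed.

(** The integral is averaged over the shifts by [t] in [-2 e, 2 e]. The last hypothesis confines the
    matrices that contribute to a dilate of [K]; dividing 8 sqrt e by the length 4 e leaves 2 / sqrt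
    e. *)
Lemma integral_root_entry_le (i j : 'I_n) (K : set 'M[R]_n) (Q : 'M[R]_n) (a e : R) :
  measurable K -> 0 <= a -> 0 < e ->
  (forall X t, `|t| <= 2 * e -> K (X + t *: delta_mx j i) ->
    K ((1 + a)^-1 *: (X + a *: Q))) ->
  (\int[lmu]_(X in K) (root_entry i j X)%:E <=
    (2 / Num.sqrt e * expR ((n * n)%:R * a))%:E * lmu K)%E.
Proof.
move=> mK a0 e0 step.
set L := [set X | K ((1 + a)^-1 *: (X + a *: Q))].
have mL : measurable L.
  have := measurable_affine_mx (1 + a)^-1 ((1 + a)^-1 *: (a *: Q)) measurableT mK.
  by rewrite setTI; congr measurable; apply/seteqP; split => X; rewrite /L/= scalerDr.
pose T := `[(- (2 * e))%R, (2 * e)%R]%classic : set RT.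
have mT : measurable T by exact: measurable_itv.
pose F (X : 'M[R]_n) : \bar R := (\1_K X * root_entry i j X)%:E.
have mF : measurable_fun setT F.
  apply/measurable_EFinP/measurable_funM; first exact: measurable_indic.
  exact: measurable_root_entry.
have F0 X : (0 <= F X)%E by rewrite lee_fin mulr_ge0// root_entry_ge0.
have -> : (\int[lmu]_(X in K) (root_entry i j X)%:E = \int[lmu]_X F X)%E.
  rewrite integral_mkcond; apply: eq_integral => X _.
  by rewrite /F patchE indicE; case: ifPn => _; rewrite ?mul1r ?mul0r.
have := translation_average (delta_mx j i) mT mF F0.
have -> : mu T = (4 * e)%:E.
  apply: etrans (lebesgue_measure_itv _) _.
  by rewrite /= lte_fin ifT; [rewrite -EFinB; congr EFin; ring|lra].
move=> avg.
have h : ((4 * e)%:E * \int[lmu]_X F X <=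
    (8 * Num.sqrt e)%:E * ((expR ((n * n)%:R * a))%:E * lmu K))%E.
  rewrite -avg; apply: (@le_trans _ _ (\int[lmu]_X ((8 * Num.sqrt e)%:E * (\1_L X)%:E))%E).
    apply: ge0_le_integral => //.
    - by move=> X _; apply: integral_ge0 => t _; rewrite mule_ge0.
    - pose f (p : 'M[R]_n * RT) :=
        ((\1_T p.2)%:E * F (p.1 + (p.2 : R) *: delta_mx j i)%R)%E.
      apply: (measurable_fun_fubini_tonelli_F (m2 := mu) f) => [|p]; last by rewrite mule_ge0.
      apply: emeasurable_funM.
        by apply/measurable_EFinP/(measurableT_comp (measurable_indic mT)).
      exact: (measurableT_comp mF (measurable_mx_line (delta_mx j i))).
    - apply: emeasurable_funM => //; exact/measurable_EFinP/measurable_indic.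
    (* Outside [L] no admissible shift of [X] meets [K], so the inner integral is 0. Inside,
       [integral_rho_shift] bounds it whatever [X] is. *)
    move=> X _; have [XL|XL] := boolP (X \in L); last first.
      rewrite indicE (negbTE XL) mule0 integral0_eq// => t _; rewrite /F.
      rewrite !indicE; have [tT|_] := boolP (t \in T); last by rewrite mul0e.
      have [XK|_] := boolP (_ \in K); last by rewrite mul0r mule0.
      exfalso; move/negP: XL; apply; apply/mem_set; apply: (step _ t); last exact: set_mem XK.
      by move/set_mem: tT; rewrite /T/= in_itv/= -ler_norml.
    rewrite indicE XL mule1; apply: le_trans (integral_rho_shift (\det X / (\adj X) i j) e0).
    apply: ge0_le_integral => //.
    - by move=> t _; rewrite mule_ge0.
    - apply: emeasurable_funM; first exact/measurable_EFinP/measurable_indic.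
      apply: (measurableT_comp mF); apply: measurable_fun_mx => k l.
      rewrite (_ : (fun _ => _) = fun t : RT => (X k l + t * delta_mx j i k l : RT)).
        by apply: measurable_funD => //; exact: measurable_funM.
      by apply/funext => t; rewrite !mxE.
    - apply/measurable_EFinP/measurable_funM; first exact: measurable_indic.
      apply: (measurableT_comp measurable_rho); exact: measurable_funD.
    move=> t _; rewrite -EFinM lee_fin ler_wpM2l//.
    apply: le_trans (root_entry_add_delta i j X t).
    by rewrite ler_piMl ?root_entry_ge0// indicE lern1 leq_b1.
  rewrite ge0_integralZl//; last by exact/measurable_EFinP/measurable_indic.
  rewrite lee_pmul2l ?lte_fin// ?integral_indic ?setIT//.
    exact: lebesgue_mx_dilate.
  by rewrite mulr_gt0// sqrtr_gt0.
have s0 : 0 < Num.sqrt e by rewrite sqrtr_gt0.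
rewrite -(@lee_pmul2l _ (4 * e)%:E) ?lte_fin ?mulr_gt0//.
apply: le_trans h _; rewrite !muleA -!EFinM.
rewrite (_ : 4 * e * _ = 8 * Num.sqrt e * expR ((n * n)%:R * a))//.
rewrite -{1}(sqr_sqrtr (ltW e0)); field; exact: lt0r_neq0.
Qed.

End row_perturbation.

(** * The cone over a spherical cap *)

Section frobenius_geometry.
Context {R : realType}.

Lemma frob_dotE m n (A B : 'M[R]_(m, n)) : frob_dot A B = \sum_i \sum_j A i j * B i j.
Proof.
by apply: eq_bigr => i _; rewrite !mxE; apply: eq_bigr => j _; rewrite !mxE.
Qed.

Lemma frob_dotC m n (A B : 'M[R]_(m, n)) : frob_dot A B = frob_dot B A.
Proof. by rewrite !frob_dotE; do 2 (apply: eq_bigr => ? _); rewrite mulrC. Qed.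

Lemma frob_dotDr m n (A B C : 'M[R]_(m, n)) :
  frob_dot A (B + C) = frob_dot A B + frob_dot A C.
Proof. by rewrite /frob_dot linearD mulmxDr linearD. Qed.

Lemma frob_dotZr m n (A B : 'M[R]_(m, n)) a : frob_dot A (a *: B) = a * frob_dot A B.
Proof. by rewrite /frob_dot linearZ -scalemxAr linearZ. Qed.

Lemma frob_dotDl m n (A B C : 'M[R]_(m, n)) :
  frob_dot (B + C) A = frob_dot B A + frob_dot C A.
Proof. by rewrite frob_dotC frob_dotDr !(frob_dotC A). Qed.

Lemma frob_dotZl m n (A B : 'M[R]_(m, n)) a : frob_dot (a *: B) A = a * frob_dot B A.
Proof. by rewrite frob_dotC frob_dotZr frob_dotC. Qed.

Lemma frob_dot_ge0 m n (A : 'M[R]_(m, n)) : 0 <= frob_dot A A.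
Proof. by rewrite frob_dotE; do 2 (apply: sumr_ge0 => ? _); rewrite -expr2 sqr_ge0. Qed.

Lemma frob_norm_ge0 m n (A : 'M[R]_(m, n)) : 0 <= frob_norm A.
Proof. exact: sqrtr_ge0. Qed.

Lemma frob_norm_sqr m n (A : 'M[R]_(m, n)) : frob_norm A ^+ 2 = frob_dot A A.
Proof. by rewrite sqr_sqrtr// frob_dot_ge0. Qed.

Lemma frob_normZ m n (A : 'M[R]_(m, n)) a : frob_norm (a *: A) = `|a| * frob_norm A.
Proof.
by rewrite /frob_norm frob_dotZl frob_dotZr mulrA -expr2 sqrtrM ?sqr_ge0// sqrtr_sqr.
Qed.

Lemma entry_le_frob_norm m n (A : 'M[R]_(m, n)) i j : `|A i j| <= frob_norm A.
Proof.
rewrite -sqrtr_sqr ler_wsqrtr// frob_dotE (bigD1 i)//= (bigD1 j)//= -expr2 -addrA lerDl.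
by rewrite addr_ge0//; do ?(apply: sumr_ge0 => ? _); rewrite -expr2 sqr_ge0.
Qed.

Lemma frob_norm_le_sum m n (A : 'M[R]_(m, n)) : frob_norm A <= \sum_i \sum_j `|A i j|.
Proof.
have S0 : 0 <= \sum_i \sum_j `|A i j| by do 2 (apply: sumr_ge0 => ? _).
rewrite -(ler_pXn2r (n := 2))// ?nnegrE ?frob_norm_ge0// frob_norm_sqr frob_dotE expr2.
rewrite big_distrl/=; apply: ler_sum => i _.
rewrite big_distrl/=; apply: ler_sum => j _.
apply: (@le_trans _ _ (`|A i j| * `|A i j|)); first by rewrite -normrM ler_norm.
rewrite ler_wpM2l// (bigD1 i)//= (bigD1 j)//= -addrA lerDl.
by rewrite addr_ge0//; do ?(apply: sumr_ge0 => ? _).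
Qed.

Lemma frob_norm0_eq0 m n (A : 'M[R]_(m, n)) : frob_norm A = 0 -> A = 0.
Proof.
move=> A0; apply/matrixP => i j; rewrite mxE; apply/eqP.
by rewrite -normr_le0 -A0 entry_le_frob_norm.
Qed.

Lemma frob_dot_le m n (A B : 'M[R]_(m, n)) : `|frob_dot A B| <= frob_norm A * frob_norm B.
Proof.
have [A0|A0] := eqVneq (frob_norm A) 0.
  by rewrite (frob_norm0_eq0 A0) /frob_dot mul0mx linear0 normr0 mulr_ge0// frob_norm_ge0.
have a0 : 0 < frob_dot A A.
  by rewrite -frob_norm_sqr exprn_gt0// lt_def A0 frob_norm_ge0.
rewrite -(ler_pXn2r (n := 2))// ?nnegrE ?mulr_ge0 ?frob_norm_ge0//.
rewrite exprMn !frob_norm_sqr -normrX ger0_norm ?sqr_ge0//.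
(* Cauchy-Schwarz: up to the factor |A|^2 this is the component of [B] orthogonal to [A]. *)
have := frob_dot_ge0 (frob_dot A A *: B - frob_dot A B *: A).
rewrite -scaleNr !(frob_dotDl, frob_dotDr, frob_dotZl, frob_dotZr) (frob_dotC B A).
set a := frob_dot A A in a0 *; set b := frob_dot A B; set c := frob_dot B B.
rewrite (_ : _ + _ = a * (a * c - b ^+ 2)); last by ring.
by rewrite pmulr_rge0// subr_ge0.
Qed.

Lemma frob_normD m n (A B : 'M[R]_(m, n)) : frob_norm (A + B) <= frob_norm A + frob_norm B.
Proof.
rewrite -(ler_pXn2r (n := 2))// ?nnegrE ?addr_ge0 ?frob_norm_ge0//.
rewrite frob_norm_sqr !(frob_dotDl, frob_dotDr) (frob_dotC B A) sqrrD !frob_norm_sqr.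
have := le_trans (ler_norm _) (frob_dot_le A B); rewrite -mulr_natl; lra.
Qed.

Lemma frob_norm_delta m n (i : 'I_m) (j : 'I_n) : frob_norm (delta_mx i j : 'M[R]_(m, n)) = 1.
Proof.
rewrite /frob_norm frob_dotE (bigD1 i)//= (bigD1 j)//= !mxE !eqxx mulr1.
rewrite big1 => [|k /negbTE kj]; last by rewrite !mxE eqxx kj mulr0.
rewrite big1 ?addr0 ?sqrtr1// => k /negbTE ki; apply: big1 => l _.
by rewrite !mxE ki mulr0.
Qed.

End frobenius_geometry.

(** * The cone over a cap as a convex body *)

Section spherical_cap.
Context {R : realType} (n : nat) (A : 'M[R]_n) (s : R).
Hypotheses (A1 : frob_norm A = 1) (s0 : 0 < s) (s1 : s <= 1).
(** The cosine of the angular radius [asin s]. *)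
Local Notation c := (Num.sqrt (1 - s ^+ 2)).
Local Notation K := (cone (cap A s)).

Lemma normalize_unit (X : 'M[R]_n) : 0 < frob_norm X -> frob_norm (normalize X) = 1.
Proof.
by move=> X0; rewrite /normalize frob_normZ gtr0_norm ?invr_gt0// mulVf// gt_eqF.
Qed.

(** The angular condition, rewritten through the cosine. In this form convexity is visible: the norm
    is convex, [c] is nonnegative and [frob_dot A] is linear. *)
Lemma cone_capP (X : 'M[R]_n) : K X <->
  frob_norm X <= 1 /\ c * frob_norm X < frob_dot A X.
Proof.
have AX := frob_dot_le A X; rewrite A1 mul1r in AX.
(* The strict inequality fails at [X = 0], where both sides vanish. *)
have X0 : c * frob_norm X < frob_dot A X -> 0 < frob_norm X.
  move=> h; rewrite lt_def frob_norm_ge0 andbT; apply: contraTneq h => E.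
  by move: AX; rewrite E mulr0 normr_le0 => /eqP ->; rewrite ltxx.
have dE : 0 < frob_norm X -> (angle A (normalize X) < asin s) =
    (c * frob_norm X < frob_dot A X).
  move=> N0; rewrite /angle /normalize frob_dotZr mulrC.
  set d := _ / _.
  have d1 : -1 <= d <= 1.
    by rewrite -ler_norml /d normrM normfV (gtr0_norm N0) ler_pdivrMr// mul1r.
  have sb : -1 <= s <= 1 by rewrite s1 andbT (le_trans _ (ltW s0))// oppr_le0.
  (* Both angles must lie in [0, pi], where the cosine is decreasing. *)
  rewrite -ltr_cos; last 2 first.
  - by rewrite in_itv/= acos_ge0// acos_lepi.
  - rewrite in_itv/=.
    have p0 := pi_gt0 R; have [as1 as2] := (asin_geNpi2 sb, asin_lepi2 sb).
    rewrite (_ : asin s <= pi) ?andbT; last lra.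
    by rewrite ltW// -ltr_sin ?in_itv/= ?as1 ?as2// ?sin0 ?asinK ?in_itv//=; lra.
  rewrite acosK ?in_itv// cos_asin// /d ltr_pdivlMr//.
split.
  move=> [[_ h] /andP[N0 N1]]; split => //; by rewrite -dE.
move=> [N1 h]; have N0 := X0 h; split; last by rewrite N0.
by split; [exact: normalize_unit|rewrite /= dE].
Qed.

Let c_ge0 : 0 <= c. Proof. exact: sqrtr_ge0. Qed.

Let c_lt : c < 1 - s ^+ 2 / 2.
Proof.
have s2 : s ^+ 2 <= 1 by rewrite exprn_ile1// ltW.
have s20 : 0 < s ^+ 2 by rewrite exprn_gt0.
rewrite -(ltr_pXn2r (n := 2))// ?nnegrE//; last lra.
rewrite sqr_sqrtr; last lra.
rewrite -subr_gt0.
have -> : (1 - s ^+ 2 / 2) ^+ 2 - (1 - s ^+ 2) = (s ^+ 2 / 2) ^+ 2 by field.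
by rewrite exprn_gt0// divr_gt0.
Qed.

(** Radius of a ball contained in the cone. Its centre [Q] lies on the axis at distance [1 - r] from
    0, so that the ball stays in the unit ball. *)
Let r := s ^+ 2 / 4.

Let Q := (1 - r) *: A.

(** The norm is at most (1 - r) + r = 1, and the component along [A] is at least 1 - 2 r = 1 - s^2 /
    2, which exceeds [c]. *)
Lemma cone_cap_ball (Y : 'M[R]_n) : frob_norm (Y - Q) <= r -> K Y.
Proof.
move=> Yr; apply/cone_capP; rewrite -[Y](subrK Q); set E := Y - Q in Yr *.
have s2 : s ^+ 2 <= 1 by rewrite exprn_ile1// ltW.
have r1 : r <= 1 by rewrite /r; lra.
have Q1 : frob_norm Q = 1 - r by rewrite frob_normZ A1 mulr1 ger0_norm// subr_ge0.
have N1 : frob_norm (E + Q) <= 1.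
  by apply: le_trans (frob_normD _ _) _; rewrite Q1; lra.
split=> //; apply: (@le_lt_trans _ _ c); first by rewrite ler_piMr.
apply: lt_le_trans c_lt _.
have := frob_dot_le A E; rewrite A1 mul1r ler_norml => /andP[AE _].
rewrite frob_dotDr frob_dotZr -(frob_norm_sqr A) A1 expr1n mulr1.
by move: AE Yr; rewrite /r; lra.
Qed.

Lemma cone_cap_convex (a : R) (X Y : 'M[R]_n) : 0 <= a -> K X -> K Y ->
  K ((1 + a)^-1 *: (X + a *: Y)).
Proof.
move=> a0 /cone_capP[X1 XA] /cone_capP[Y1 YA]; have a1 : 0 < 1 + a by lra.
have b0 : 0 < (1 + a)^-1 by rewrite invr_gt0.
have N : frob_norm (X + a *: Y) <= frob_norm X + a * frob_norm Y.
  by apply: le_trans (frob_normD _ _) _; rewrite frob_normZ ger0_norm.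
apply/cone_capP; rewrite frob_normZ gtr0_norm// frob_dotZr; split.
  rewrite mulrC ler_pdivrMr// mul1r; apply: le_trans N _.
  by rewrite lerD// ler_piMr.
rewrite mulrCA ltr_pM2l// frob_dotDr frob_dotZr.
apply: le_lt_trans (ler_wpM2l c_ge0 N) _; rewrite mulrDr mulrCA.
by apply: ltr_leD => //; rewrite ler_wpM2l// ltW.
Qed.

(** The displacement [D] is absorbed by the inscribed ball: X + a Q = (X + D) + a (Q - D / a), where
    Q - D / a is still in the ball. This supplies the last hypothesis of
    [integral_root_entry_le]. *)
Lemma cone_cap_step (a : R) (X D : 'M[R]_n) : 0 < a ->
  frob_norm D <= a * r -> K (X + D) -> K ((1 + a)^-1 *: (X + a *: Q)).
Proof.
move=> a0 Dr KX.
have -> : X + a *: Q = (X + D) + a *: (Q - a^-1 *: D).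
  by apply/matrixP => i j; rewrite !mxE; field; rewrite gt_eqF.
apply: cone_cap_convex (ltW a0) KX _; apply: cone_cap_ball.
rewrite addrC addKr -scaleNr frob_normZ normrN gtr0_norm ?invr_gt0//.
by rewrite mulrC ler_pdivrMr// mulrC.
Qed.

Lemma measurable_cone_cap : measurable K.
Proof.
have mn := measurable_normalize (n := n) measurableT (measurable_cap A s).
have := @measurable_frob_norm R n n measurableT _ (measurable_itv `]0, 1]).
rewrite setTI in mn; rewrite setTI => /(measurableI _ _ mn); congr measurable.
Qed.

Lemma cone_cap_volume_gt0 : (0 < lebesgue_mx K)%E.
Proof.
(* The norm is at most the sum of n^2 entries, so this cube lies in the ball of radius [r]. The
   successor keeps [d] positive even for [n = 0]. *)
pose d := r / (n * n).+1%:R.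
have r0 : 0 < r by rewrite /r divr_gt0// exprn_gt0.
have d0 : 0 < d by rewrite divr_gt0.
apply: (@lt_le_trans _ _ (lebesgue_mx (mx_cube Q d))).
  by rewrite lebesgue_mx_cube ?ltW// lte_fin exprn_gt0// mulr_gt0.
apply: le_measure => [||X h].
- by apply/mem_set; exact: measurable_mx_cube.
- by apply/mem_set; exact: measurable_cone_cap.
 apply: cone_cap_ball; apply: le_trans (frob_norm_le_sum _) _.
apply: (@le_trans _ _ (\sum_(i < n) \sum_(j < n) d)).
  by apply: ler_sum => i _; apply: ler_sum => j _; move: (h i j); rewrite !mxE.
rewrite !sumr_const !card_ord -mulrnA -mulr_natr /d mulrAC ler_pdivrMr//.
by apply: ler_wpM2l; [exact: ltW|rewrite ler_nat].
Qed.

Lemma cone_cap_volume_lty : (lebesgue_mx K < +oo)%E.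
Proof.
apply: (@le_lt_trans _ _ (lebesgue_mx (mx_cube (0 : 'M[R]_n) 1))); last first.
  by rewrite lebesgue_mx_cube// ltry.
apply: le_measure => [||X [_ /andP[_ X1]] i j].
- by apply/mem_set; exact: measurable_cone_cap.
- by apply/mem_set; exact: measurable_mx_cube.
 rewrite mxE subr0.
exact: le_trans (entry_le_frob_norm _ _ _) X1.
Qed.

End spherical_cap.

(** * The condition number *)

Section integral_extra.
Local Open Scope ereal_scope.
Context d (T : measurableType d) (R : realType) (mu : {measure set T -> \bar R}).

(* f need not be measurable: nonnegative integrals are suprema over simple functions. *)
Lemma integral_le_ge0 (f g : T -> \bar R) : (forall x, f x <= g x) ->
  (forall x, 0 <= g x) -> \int[mu]_x f x <= \int[mu]_x g x.
Proof.
move=> fg g0; rewrite [leRHS]ge0_integralTE// integralE.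
apply: (@le_trans _ _ (\int[mu]_x f^\+ x)).
  rewrite -[leRHS]sube0; apply: leeB => //.
  by apply: integral_ge0 => x _; exact: funeneg_ge0.
rewrite ge0_integralTE//; apply: le_ereal_sup => _ [h hf <-]; exists h => // x.
apply: le_trans (hf x) _; by rewrite funeposE ge_max fg g0.
Qed.

Lemma ge0_integral_mrestr (D : set T) (mD : measurable D) (f : T -> \bar R) :
  measurable_fun setT f -> (forall x, 0 <= f x) ->
  \int[mrestr mu mD]_x f x = \int[mu]_(x in D) f x.
Proof.
move=> mf f0.
rewrite (@ge0_negligible_integral _ _ _ (mrestr mu mD) setT (~` D))//.
- rewrite setTD setCK; apply: eq_measure_integral => A mA AD.
  change (mu (A `&` D) = mu A); by rewrite setIidl.
- exact: measurableC.
- by change (mu (~` D `&` D) = 0); rewrite setICl measure0.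
Qed.

End integral_extra.

(** * A pointwise majorant of the logarithm of the condition number *)

Section condition_number.
Context {R : realType} (n : nat).

Lemma inv_entryE (Z : 'M[R]_n) i j : Z \in unitmx -> inv_entry i j Z = invmx Z i j.
Proof. by move=> Zu; rewrite /invmx Zu !mxE /inv_entry !mxE mulrC. Qed.

Lemma opnorm_le_sum (B : 'M[R]_n) : opnorm B <= \sum_i \sum_j `|B i j|.
Proof.
apply: ge_sup.
  exists (frob_norm (B *m (0 : 'cV[R]_n))); exists 0 => //=.
  by rewrite /frob_norm /frob_dot mul0mx linear0 sqrtr0.
move=> _ [x /= x1 <-]; apply: le_trans (frob_norm_le_sum _) _.
apply: ler_sum => i _; rewrite big_ord1 mxE.
apply: le_trans (ler_norm_sum _ _ _) _; apply: ler_sum => j _.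
rewrite normrM ler_piMr//; exact: le_trans (entry_le_frob_norm _ _ _) x1.
Qed.

Lemma sqrt_sum_le (I : Type) (s : seq I) (F : I -> R) : (forall i, 0 <= F i) ->
  Num.sqrt (\sum_(i <- s) F i) <= \sum_(i <- s) Num.sqrt (F i).
Proof.
move=> F0; elim: s => [|x s IH]; first by rewrite !big_nil sqrtr0.
rewrite !big_cons; apply: (@le_trans _ _ (Num.sqrt (F x) + Num.sqrt (\sum_(i <- s) F i))).
  rewrite -(ler_pXn2r (n := 2))// ?nnegrE ?addr_ge0 ?sqrtr_ge0//.
  have S0 : 0 <= \sum_(i <- s) F i by apply: sumr_ge0.
  rewrite sqrrD !sqr_sqrtr// ?addr_ge0//.
  by rewrite lerD2r lerDl mulrn_wge0// mulr_ge0// sqrtr_ge0.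
by rewrite lerD2l.
Qed.

(** Bounds the square root of [kappa_F] on invertible matrices. The square root is taken because
    |u|^(-1/2) is integrable near 0 while 1 / |u| is not. *)
Definition root_sum (Z : 'M[R]_n) : R :=
  Num.sqrt (frob_norm Z) * \sum_i \sum_j root_entry i j Z.

Lemma sqrt_kappa_le (Z : 'M[R]_n) : Z \in unitmx ->
  Num.sqrt (frob_norm Z * opnorm (invmx Z)) <= root_sum Z.
Proof.
move=> Zu; rewrite /root_sum sqrtrM ?frob_norm_ge0// ler_wpM2l ?sqrtr_ge0//.
apply: le_trans (ler_wsqrtr (opnorm_le_sum _)) _.
apply: le_trans (sqrt_sum_le _ _) _ => [i|]; first by apply: sumr_ge0.
apply: ler_sum => i _; apply: le_trans (sqrt_sum_le _ _) _ => [j|]; first by [].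
by apply: ler_sum => j _; rewrite /root_entry inv_entryE.
Qed.

Lemma root_sum_ge0 Z : 0 <= root_sum Z.
Proof.
by rewrite mulr_ge0 ?sqrtr_ge0//; do 2 (apply: sumr_ge0 => ? _); exact: root_entry_ge0.
Qed.

(** The inverse of [normalize X] is the inverse of [X] times [frob_norm X], a factor at most 1. *)
Lemma root_sum_normalize (X : 'M[R]_n) : X \in unitmx -> 0 < frob_norm X <= 1 ->
  root_sum (normalize X) <= \sum_i \sum_j root_entry i j X.
Proof.
move=> Xu /andP[X0 X1]; rewrite /root_sum normalize_unit// sqrtr1 mul1r.
have Nu : normalize X \in unitmx by rewrite unitmxZ// unitfE invr_eq0 gt_eqF.
apply: ler_sum => i _; apply: ler_sum => j _; rewrite /root_entry !inv_entryE//.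
rewrite ler_wsqrtr// invmxZ// mxE invrK normrM ler_piMl//.
by rewrite gtr0_norm.
Qed.

(* The indicator term makes the majorant +oo on singular matrices, where root_sum is
   a junk value; elsewhere this is the tangent of the logarithm at M. *)
Definition log_majorant (M : R) (Z : 'M[R]_n) : \bar R :=
  ((2 * (ln M - 1) + 2 / M * root_sum Z)%:E + (\1_(@singular R n) Z)%:E * +oo)%E.

(** For invertible [Z], ln k = 2 ln (sqrt k), and the concave logarithm lies below its tangent at
    [M]. This is Jensen's inequality in pointwise form, with [M] in place of the mean of sqrt k. *)
Lemma lne_kappa_le (M : R) (Z : 'M[R]_n) : 0 < M ->
  (lne (kappa_F Z) <= log_majorant M Z)%E.
Proof.
move=> M0; rewrite /kappa_F /log_majorant indicE; case: ifPn => Zu; last first.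
  rewrite mem_set; last by apply/eqP; move: Zu; rewrite unitmxE unitfE negbK.
  by rewrite mul1e addey.
rewrite memNset; last by apply/eqP; rewrite -unitfE -unitmxE.
(* For [k <= 0] the value of [lne] is -oo. *)
rewrite mul0e adde0; set k := _ * opnorm _; rewrite /lne; case: ifPn => [_|].
  by rewrite leNye.
rewrite -ltNge => k0; rewrite lee_fin.
have w0 : 0 < Num.sqrt k by rewrite sqrtr_gt0.
have -> : ln k = 2 * ln (Num.sqrt k).
  by rewrite -{1}(sqr_sqrtr (ltW k0)) lnXn// mulr_natl.
have : ln (Num.sqrt k / M) <= Num.sqrt k / M - 1.
  have := @le_ln1Dx R (Num.sqrt k / M - 1); rewrite addrCA subrr addr0; apply.
  by rewrite ltrBrDl subrr divr_gt0.
rewrite lnM ?posrE ?invr_gt0// lnV ?posrE// => h.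
have : Num.sqrt k / M <= root_sum Z / M.
  by apply: ler_wpM2r; [rewrite invr_ge0 ltW|exact: sqrt_kappa_le].
have -> : 2 / M * root_sum Z = 2 * (root_sum Z / M) by ring.
lra.
Qed.

Lemma measurable_log_majorant M : measurable_fun setT (log_majorant M).
Proof.
apply: emeasurable_funD.
  apply/measurable_EFinP/measurable_funD => //; apply: measurable_funM => //.
  apply: measurable_funM.
    exact: (measurableT_comp measurable_sqrt (@measurable_frob_norm R n n)).
  apply: measurable_sum => i; apply: measurable_sum => j.
  exact: measurable_root_entry.
apply: emeasurable_funM => //; apply/measurable_EFinP/measurable_indic.
exact: measurable_singular.
Qed.

(** The condition [1 <= ln M] makes the constant term of the tangent nonnegative, so that
    nonnegative integration applies. *)
Lemma log_majorant_ge0 M Z : 1 <= ln M -> 0 < M -> (0 <= log_majorant M Z)%E.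
Proof.
move=> M1 M0; rewrite /log_majorant; apply: adde_ge0; last exact: mule_ge0.
rewrite lee_fin; apply: addr_ge0; apply: mulr_ge0 => //.
- by rewrite subr_ge0.
- by rewrite divr_ge0// ltW.
- exact: root_sum_ge0.
Qed.

End condition_number.

(* n^2 times the bound of integral_root_entry_cap. *)
Definition cap_mean_bound {R : realType} (n : nat) (s : R) : R :=
  8 * expR (2^-1) * n%:R ^+ 3 / s.

(** * Expectations over a cap as integrals over the cone *)

Section uniform_cap.
Context {R : realType} (n : nat) (A : 'M[R]_n) (s : R).
Hypotheses (n0 : (0 < n)%N) (A1 : frob_norm A = 1) (s0 : 0 < s) (s1 : s <= 1).
Local Notation K := (cone (cap A s)).
Local Notation lmu := (@lebesgue_mx R n n).

Let mK : measurable K := measurable_cone_cap A s.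

Let k := fine (lmu K).

Let lmuK : lmu K = k%:E.
Proof.
rewrite fineK// ge0_fin_numE; first exact: cone_cap_volume_lty.
exact: measure_ge0.
Qed.

Let k0 : 0 < k.
Proof. by rewrite -lte_fin -lmuK cone_cap_volume_gt0. Qed.

(** The factor n^2 of [sphere_volume] cancels. The mass n^2 k of the cap is positive and finite, so
    [mnormalize] does divide by it. *)
Lemma uniform_capE (V : set 'M[R]_n) :
  uniform_cap A s V = ((k^-1)%:E * lmu (normalize (n := n) @^-1` V `&` K))%E.
Proof.
have N0 : (0 : R) < (n * n)%:R by rewrite ltr0n muln_gt0 n0.
have volE (W : set 'M[R]_n) : sphere_volume (W `&` cap A s) =
    ((n * n)%:R%:E * lmu (normalize (n := n) @^-1` W `&` K))%E.
  congr (_ * lmu _)%E; apply/seteqP; split => X /=; first by move=> [[? ?] ?].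
  by move=> [? [? ?]].
have Tk : sphere_volume (setT `&` cap A s) = ((n * n)%:R * k)%:E.
  by rewrite volE preimage_setT setTI lmuK EFinM.
rewrite /uniform_cap /= /mnormalize/= /mrestr Tk.
rewrite eqe gt_eqF ?mulr_gt0//= volE muleC muleA -EFinM; congr (_%:E * _)%E.
by field; rewrite (gt_eqF k0) pnatr_eq0 -lt0n n0.
Qed.

(** The uniform measure is the image under [normalize] of Lebesgue measure on [K] divided by [k]. *)
Lemma integral_uniform_cap (G : 'M[R]_n -> \bar R) :
  measurable_fun setT G -> (forall Z, 0 <= G Z)%E ->
  (\int[uniform_cap A s]_Z G Z = (k^-1)%:E * \int[lmu]_(X in K) G (normalize X))%E.
Proof.
move=> mG G0.
have ki : 0 <= k^-1 by rewrite invr_ge0 ltW.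
have mn := @measurable_normalize R n.
pose nu := mscale (NngNum ki) (measure_function_pushforward__canonical__measure_function_Measure
     (mrestr lmu mK) mn).
transitivity (\int[nu]_Z G Z)%E.
  by apply: eq_measure_integral => V mV _; exact: uniform_capE.
rewrite ge0_integral_mscale//; congr (_ * _)%E.
have := ge0_integral_pushforward mn (mrestr lmu mK) measurableT mG (fun Z _ => G0 Z).
rewrite preimage_setT => ->; apply: ge0_integral_mrestr => [|X]; last exact: G0.
exact: (measurableT_comp mG mn).
Qed.


Lemma integral_root_entry_cap i j :
  (\int[lmu]_(X in K) (root_entry i j X)%:E <= (8 * expR (2^-1) * n%:R / s * k)%:E)%E.
Proof.
have nR : (0 : R) < n%:R by rewrite ltr0n.
have N0 : (0 : R) < (n * n)%:R by rewrite ltr0n muln_gt0 n0.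
(* This [a] makes the volume ratio exp (n^2 a) equal to exp (1/2). Then [e] is chosen so that 2 e =
   a s^2 / 4, the largest displacement that [cone_cap_step] allows. *)
pose a : R := (2 * (n * n)%:R)^-1.
have a0 : 0 < a by rewrite invr_gt0 mulr_gt0.
pose e : R := (s / (4 * n%:R)) ^+ 2.
have q0 : 0 < s / (4 * n%:R) by rewrite divr_gt0 ?mulr_gt0.
have e0 : 0 < e by rewrite exprn_gt0.
have := @integral_root_entry_le R n i j K ((1 - s ^+ 2 / 4) *: A) a e mK (ltW a0) e0.
have -> : (n * n)%:R * a = 2^-1 by rewrite /a; field; rewrite gt_eqF.
have -> : Num.sqrt e = s / (4 * n%:R) by rewrite sqrtr_sqr gtr0_norm.
rewrite lmuK -EFinM.
have -> : 2 / (s / (4 * n%:R)) * expR 2^-1 * k = 8 * expR 2^-1 * n%:R / s * k.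
  by field; rewrite !gt_eqF.
apply => X t te; apply: cone_cap_step => //.
rewrite frob_normZ frob_norm_delta mulr1; apply: le_trans te _.
by rewrite le_eqVlt; apply/orP; left; apply/eqP; rewrite /e /a natrM; field; rewrite gt_eqF.
Qed.

Local Notation M := (cap_mean_bound n s).

Lemma cap_mean_bound_gt0 : 0 < M.
Proof.
apply: divr_gt0 => //; apply: mulr_gt0; last by rewrite exprn_gt0// ltr0n.
by apply: mulr_gt0 => //; exact: expR_gt0.
Qed.

Let ln_M : ln M = 3 * ln 2 + 2^-1 + 3 * ln n%:R - ln s.
Proof.
have nR : (0 : R) < n%:R by rewrite ltr0n.
rewrite /cap_mean_bound lnM ?posrE ?invr_gt0 ?mulr_gt0 ?expR_gt0 ?exprn_gt0//.
rewrite lnM ?posrE ?mulr_gt0 ?expR_gt0 ?exprn_gt0//.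
rewrite lnM ?posrE ?expR_gt0// expRK lnXn// lnV ?posrE//.
have -> : 8 = 2 ^+ 3 :> R by ring.
by rewrite lnXn// -[ln 2 *+ 3]mulr_natl -[ln n%:R *+ 3]mulr_natl.
Qed.

(** Already 3 ln 2 + 1/2 is at least 2, since ln 2 >= 1/2; the other terms are nonnegative. *)
Lemma ln_cap_mean_bound_ge1 : 1 <= ln M.
Proof.
have ln2 : 2^-1 <= ln 2 :> R.
  rewrite -[ln 2]opprK -lnV ?posrE// lerNr.
  have -> : 2^-1 = 1 + - 2^-1 :> R by field.
  rewrite (_ : - (1 + - 2^-1) = - 2^-1); last by field.
  by apply: le_ln1Dx; rewrite ltrN2 invf_lt1// ltr1n.
have lnn : 0 <= ln n%:R :> R by rewrite ln_ge0// ler1n.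
have lns := ln_le0 s1.
rewrite ln_M; lra.
Qed.

(** [M] bounds the mean over [K] of the sum of the [root_entry], so the tangent of 2 ln at [M]
    averages to at most its value 2 ln M there. *)
Lemma integral_log_majorant :
  (\int[uniform_cap A s]_Z log_majorant M Z <= (2 * ln M)%:E)%E.
Proof.
have M0 := cap_mean_bound_gt0.
have G0 Z := log_majorant_ge0 Z ln_cap_mean_bound_ge1 M0.
have mG := @measurable_log_majorant R n M.
rewrite integral_uniform_cap//.
rewrite -(@lee_pmul2l _ k%:E) ?lte_fin// muleA -EFinM divff ?gt_eqF// mul1e.
pose H (X : 'M[R]_n) := 2 * (ln M - 1) + 2 / M * \sum_i \sum_j root_entry i j X.
have M2 : 0 <= 2 / M by rewrite divr_ge0// ltW.
have S0 (X : 'M[R]_n) : 0 <= \sum_i \sum_j root_entry i j X.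
  by do 2 (apply: sumr_ge0 => ? _); exact: root_entry_ge0.
have L0 : 0 <= 2 * (ln M - 1) by rewrite mulr_ge0// subr_ge0 ln_cap_mean_bound_ge1.
have H0 X : 0 <= H X by rewrite addr_ge0// mulr_ge0.
have mS : measurable_fun setT (fun X : 'M[R]_n => \sum_i \sum_j root_entry i j X).
  by apply: measurable_sum => i; apply: measurable_sum => j; exact: measurable_root_entry.
have mH : measurable_fun setT H.
  by apply: measurable_funD => //; apply: measurable_funM.
apply: (@le_trans _ _ (\int[lmu]_(X in K) (H X)%:E)%E).
  (* On singular matrices the majorant is +oo and the comparison fails, but they form a null set. *)
  apply: ae_ge0_le_integral => //.
  - apply: measurable_funTS; exact: (measurableT_comp mG (@measurable_normalize R n)).
  - by move=> X _; rewrite lee_fin.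
  - by apply: measurable_funTS; apply/measurable_EFinP.
  exists (@singular R n); split; [exact: measurable_singular|exact: lebesgue_mx_singular|].
  move=> X /=; apply: contra_notP => Xs [_ X1]; rewrite /log_majorant.
  have Xu : X \in unitmx by rewrite unitmxE unitfE; apply/eqP.
  have X0 : 0 < frob_norm X by case/andP : X1.
  rewrite indicE memNset ?mul0e ?adde0; last first.
    by apply/eqP; rewrite -unitfE -unitmxE unitmxZ// unitfE invr_eq0 gt_eqF.
  by rewrite lee_fin lerD2l ler_wpM2l// root_sum_normalize.
rewrite (_ : (fun X => _) = fun X => ((2 * (ln M - 1))%:E +
    (2 / M)%:E * (\sum_i \sum_j root_entry i j X)%:E)%E); last first.
  by apply/funext => X; rewrite -EFinM -EFinD.
have mSE : measurable_fun K (fun X : 'M[R]_n => (\sum_i \sum_j root_entry i j X)%:E).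
  by apply: measurable_funTS; apply/measurable_EFinP.
rewrite ge0_integralD//.
2: by move=> X _; rewrite -EFinM lee_fin mulr_ge0.
2: exact: emeasurable_funM.
have -> : (\int[lmu]_(X in K) (2 * (ln M - 1))%:E = (2 * (ln M - 1) * k)%:E)%E.
  by rewrite integral_cst// [RHS]EFinM; congr (_ * _)%E; exact: lmuK.
rewrite ge0_integralZl//; last by move=> *; rewrite lee_fin.
have -> : (\int[lmu]_(X in K) (\sum_i \sum_j root_entry i j X)%:E =
    \sum_i \sum_j \int[lmu]_(X in K) (root_entry i j X)%:E)%E.
  under eq_integral do rewrite -sumEFin.
  rewrite ge0_integral_sum//.
  - apply: eq_bigr => i _; under eq_integral do rewrite -sumEFin.
    rewrite ge0_integral_sum// => j.
    + by apply: measurable_funTS; apply/measurable_EFinP; exact: measurable_root_entry.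
    + by move=> X _; rewrite lee_fin root_entry_ge0.
  - move=> i; apply: measurable_funTS; apply/measurable_EFinP/measurable_sum => j.
    exact: measurable_root_entry.
  - by move=> i X _; rewrite lee_fin; apply: sumr_ge0 => ? _; exact: root_entry_ge0.
apply: (@le_trans _ _ ((2 * (ln M - 1) * k)%:E + (2 / M)%:E *
    \sum_(i < n) \sum_(j < n) (8 * expR (2^-1) * n%:R / s * k)%:E)%E).
  rewrite leeD// lee_wpmul2l ?lee_fin//; apply: lee_sum => i _; apply: lee_sum => j _.
  exact: integral_root_entry_cap.
under eq_bigr do rewrite sumEFin.
rewrite sumEFin -EFinM -EFinD lee_fin !sumr_const !card_ord -mulrnA -(mulr_natr _ (n * n)).
(* The n^2 equal bounds add up to [M * k], so the total becomes (2 (ln M - 1) + 2) k. *)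
rewrite natrM (_ : _ * _ * (n%:R * n%:R) = M * k); last by rewrite /cap_mean_bound; field; rewrite gt_eqF.
by rewrite mulrA divfK ?gt_eqF//; lra.
Qed.

(** The numerical part of 2 ln M is 6 ln 2 + 1, and ln 2 <= 3/4 gives 9/2 + 1 = 11/2. *)
Lemma ln_cap_mean_bound_le : 2 * ln M <= 6 * ln n%:R + 2 * ln (1 / s) + 11 / 2.
Proof.
rewrite ln_M div1r lnV ?posrE//.
have : ln 2 <= 3 / 4 :> R.
  rewrite -[leRHS]expRK ler_ln ?posrE ?expR_gt0//.
  have -> : 3 / 4 = 3 / 32 * 8%:R :> R by field.
  (* Here exp (3/4) = exp (3/32)^8 >= (1 + 3/32)^8 >= 2. *)
  rewrite expRM_natr; apply: (@le_trans _ _ ((1 + 3 / 32) ^+ 8)); first by lra.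
  by apply: lerXn2r; rewrite ?nnegrE ?expR_ge0 ?expR_ge1Dx//; lra.
lra.
Qed.

End uniform_cap.

(** * The supremum over the centres of the caps *)

Theorem corollary4p1 (R : realType) (n : nat) (sigma : R)
    (n_ge1 : (1 <= n)%N) (sigma_gt0 : 0 < sigma) (sigma_le1 : sigma <= 1) :
  (ereal_sup [set \int[uniform_cap A sigma]_Z lne (kappa_F Z)
             | A in @unit_sphere R n]
   <= (6 * ln n%:R + 2 * ln (1 / sigma) + 11 / 2)%:E)%E.
Proof.
apply: ge_ereal_sup => _ [A A1 <-].
have M0 := cap_mean_bound_gt0 n_ge1 sigma_gt0.
apply: (@le_trans _ _ (2 * ln (cap_mean_bound n sigma))%:E); last first.
  by rewrite lee_fin ln_cap_mean_bound_le.
apply: le_trans (integral_log_majorant n_ge1 A1 sigma_gt0 sigma_le1).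
apply: integral_le_ge0 => Z; first exact: lne_kappa_le.
by apply: log_majorant_ge0 => //; exact: ln_cap_mean_bound_ge1.
Qed.
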